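(* Let $R=k[[x_1,\dots,x_n]]$ and let $I\subset R$ be an ideal. Then for every integer $m\ge 0$, $I^{(m+1)\text{-}jc}\subset I^{m\text{-}jc}$.
   Context: $k$ is an algebraically closed field of characteristic $0$, and $\mathfrak m$ is the maximal ideal of $R$. For an integer $m\ge 0$ put $P_m=k[x_i^{(j)}: 1\le i\le n,\ 1\le j\le m]$. For $g\in R$ define $D_0(g),\dots,D_m(g)\in P_m$ by $$g\Big(\sum_{j=1}^m x_1^{(j)}t^j,\dots,\sum_{j=1}^m x_n^{(j)}t^j\Big)\equiv\sum_{j=0}^m D_j(g)\,t^j \pmod{t^{m+1}}.$$ For an ideal $I\subset R$ let $\overline{I}_m\subset P_m$ be the ideal generated by all $D_j(g)$ with $g\in I$, $0\le j\le m$. (Here $P_m$ is the $m$-th jet ring $R_m$ modulo $\mathfrak m R_m$, and $\overline I_m$ is the image of the $m$-th jet ideal of $I$.) The $m$-th jet closure of $I$ is $$I^{m\text{-}jc}=\{f\in R: D_j(f)\in \overline I_m \text{ for all } 0\le j\le m\}.$$ *)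

(* Defs.v *)
From HB Require Import structures.
From mathcomp Require Import all_boot all_order all_algebra.
From mathcomp Require Import boolp classical_sets.
From mathcomp Require Import mpoly.

Set Implicit Arguments.
Unset Strict Implicit.
Unset Printing Implicit Defensive.

Import GRing.Theory.
Local Open Scope ring_scope.
Local Open Scope classical_set_scope.

(* [mseries n R] is R[[x_1, ..., x_n]]: a series is its family of coefficients,
   indexed by the exponents ['X_{1..n}], and the product is the Cauchy product,
   with the same formula as [mcoeffM]. *)
Record mseries (n : nat) (R : Type) :=
  MSeries { mscoeff :> 'X_{1..n} -> R }.

Lemma mseriesP n R (f g : mseries n R) : (forall m, f m = g m) -> f = g.
Proof. by case: f g => [f] [g] /= /funext ->. Qed.

HB.instance Definition _ n R := gen_eqMixin (mseries n R).
HB.instance Definition _ n R := gen_choiceMixin (mseries n R).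

Section MSeriesRing.
Variables (n : nat) (R : comNzRingType).
Implicit Types (f g h : mseries n R) (m : 'X_{1..n}).

Definition mseries0 : mseries n R := MSeries (fun=> 0).
Definition mseries1 : mseries n R := MSeries (fun m => (m == 0%MM)%:R).
Definition mseries_opp f : mseries n R := MSeries (fun m => - f m).
Definition mseries_add f g : mseries n R := MSeries (fun m => f m + g m).
Definition mseries_mul f g : mseries n R :=
  MSeries (fun m =>
    \sum_(k : 'X_{1..n < (mdeg m).+1, (mdeg m).+1} | m == (k.1 + k.2)%MM)
      f k.1 * g k.2).

Fact mseries_addA : associative mseries_add.
Proof. by move=> f g h; apply: mseriesP => m /=; rewrite addrA. Qed.
Fact mseries_addC : commutative mseries_add.
Proof. by move=> f g; apply: mseriesP => m /=; rewrite addrC. Qed.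
Fact mseries_add0 : left_id mseries0 mseries_add.
Proof. by move=> f; apply: mseriesP => m /=; rewrite add0r. Qed.
Fact mseries_addN : left_inverse mseries0 mseries_opp mseries_add.
Proof. by move=> f; apply: mseriesP => m /=; rewrite addNr. Qed.

HB.instance Definition _ := GRing.isZmodule.Build (mseries n R)
  mseries_addA mseries_addC mseries_add0 mseries_addN.

(* The terms of [f] of total degree < [d]. *)
Definition mstrunc (d : nat) f : {mpoly R[n]} :=
  \sum_(m : 'X_{1..n < d}) f m *: 'X_[m].

Lemma mcoeff_mstrunc d f m : (mdeg m < d)%N -> (mstrunc d f)@_m = f m.
Proof. exact: mcoeff_mpoly. Qed.

Lemma leq_mdegD (a b c : 'X_{1..n}) : c = (a + b)%MM ->
  (mdeg a <= mdeg c)%N * (mdeg b <= mdeg c)%N.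
Proof. by move=> ->; rewrite mdegD leq_addr leq_addl. Qed.

Lemma mcoeffM_eq (p p' q q' : {mpoly R[n]}) m :
  (forall k, (mdeg k <= mdeg m)%N -> p@_k = p'@_k) ->
  (forall k, (mdeg k <= mdeg m)%N -> q@_k = q'@_k) ->
  (p * q)@_m = (p' * q')@_m.
Proof.
move=> Hp Hq; rewrite !mcoeffM; apply: eq_bigr => k /eqP Ek.
by rewrite Hp ?Hq // (leq_mdegD Ek).
Qed.

Lemma mseries_mulE d f g m : (mdeg m < d)%N ->
  mseries_mul f g m = (mstrunc d f * mstrunc d g)@_m.
Proof.
move=> lt_md; rewrite mcoeffM /=; apply: eq_bigr => k /eqP Ek.
by rewrite !mcoeff_mstrunc // (leq_ltn_trans _ lt_md) // (leq_mdegD Ek).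
Qed.

Fact mseries_mulC : commutative mseries_mul.
Proof.
by move=> f g; apply: mseriesP => m; rewrite !(mseries_mulE _ _ (ltnSn _)) mulrC.
Qed.

Fact mseries_mulA : associative mseries_mul.
Proof.
move=> f g h; apply: mseriesP => m; rewrite !(mseries_mulE _ _ (ltnSn _)).
set d := (mdeg m).+1.
have E u v k : (mdeg k <= mdeg m)%N ->
    (mstrunc d (mseries_mul u v))@_k = (mstrunc d u * mstrunc d v)@_k.
  by move=> le_km; rewrite mcoeff_mstrunc // (@mseries_mulE d).
transitivity (mstrunc d f * (mstrunc d g * mstrunc d h))@_m.
  exact: mcoeffM_eq (E _ _).
by rewrite mulrA; apply: mcoeffM_eq => // k le_km; rewrite E.
Qed.

Fact mseries_mul1 : left_id mseries1 mseries_mul.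
Proof.
move=> f; apply: mseriesP => m; rewrite (mseries_mulE _ _ (ltnSn _)).
rewrite (@mcoeffM_eq _ 1 _ (mstrunc (mdeg m).+1 f)) // => [|k le_km].
  by rewrite mul1r mcoeff_mstrunc.
by rewrite mcoeff_mstrunc // mcoeff1.
Qed.

Fact mseries_mulD : left_distributive mseries_mul mseries_add.
Proof.
move=> f g h; apply: mseriesP => m /=; rewrite -big_split /=.
by apply: eq_bigr => k _; rewrite mulrDl.
Qed.

Fact mseries_1neq0 : mseries1 != 0.
Proof.
apply/eqP => /(congr1 (fun f : mseries n R => f 0%MM)) /= /eqP.
by rewrite eqxx oner_eq0.
Qed.

HB.instance Definition _ := GRing.Zmodule_isComNzRing.Build (mseries n R)
  mseries_mulA mseries_mulC mseries_mul1 mseries_mulD mseries_1neq0.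

End MSeriesRing.

(* Unlike [idealr_closed], ideals need not be proper (nor decidable). *)
Definition is_ideal (A : comNzRingType) (I : set A) : Prop :=
  [/\ I 0, forall a b, I a -> I b -> I (a + b)
    & forall c a, I a -> I (c * a)].

Definition ideal_gen (A : comNzRingType) (S : set A) : set A :=
  smallest (@is_ideal A) S.

Section Jets.
Variables (n : nat) (k : comNzRingType) (m : nat).

(* P_m; its variable x_i^(j), 1 <= j <= m, is ['X_(mxvec_index i j')] where
   [j' : 'I_m] has value j - 1. *)
Definition jet_ring : comNzRingType := {mpoly k[(n * m)%N]}.

Definition jet_arc (i : 'I_n) : {poly jet_ring} :=
  \sum_(j < m) ('X_(mxvec_index i j) : jet_ring) *: 'X^(j.+1).

Definition jet_subst (p : {mpoly k[n]}) : {poly jet_ring} :=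
  mmap (polyC \o @mpolyC (n * m) k) jet_arc p.

(* D_j(g). The arcs have no constant term, so modulo t^(m+1) only the terms of
   [g] of degree <= m contribute; [jetDE] shows that any longer truncation of
   [g] gives the same coefficients. *)
Definition jetD (j : nat) (g : mseries n k) : jet_ring :=
  (jet_subst (mstrunc m.+1 g))`_j.

Lemma jet_arc_dvd (a : 'X_{1..n}) :
  exists q, mmap1 jet_arc a = q * 'X^(mdeg a).
Proof.
pose s i := \sum_(j < m) ('X_(mxvec_index i j) : jet_ring) *: 'X^j : {poly jet_ring}.
exists (\prod_i s i ^+ a i); rewrite mdegE -prodrXr -big_split /=.
rewrite /mmap1; apply: eq_bigr => i _; rewrite -exprMn; congr (_ ^+ _).
rewrite /jet_arc /s mulr_suml; apply: eq_bigr => j _.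
by rewrite exprSr scalerAl.
Qed.

Lemma jetDE d j (g : mseries n k) : (j <= m)%N -> (m < d)%N ->
  jetD j g = (jet_subst (mstrunc d g))`_j.
Proof.
move=> le_jm lt_md; apply/eqP; rewrite -subr_eq0 -coefB /jet_subst -raddfB /=.
rewrite /mmap coef_sum big_seq big1 // => a.
rewrite mcoeff_msupp mcoeffB => a_supp.
have [lt_ma | le_am] := ltnP m (mdeg a).
  have [q ->] := jet_arc_dvd a.
  by rewrite mulrA coefMXn (leq_ltn_trans le_jm lt_ma).
by rewrite !mcoeff_mstrunc ?subrr ?eqxx ?(leq_ltn_trans le_am) in a_supp *.
Qed.

End Jets.

Arguments jetD {n k} m j g.

Definition jet_ideal n (k : comNzRingType) m (I : set (mseries n k)) :
    set (jet_ring n k m) :=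
  ideal_gen [set p | exists g j, [/\ I g, (j <= m)%N & p = jetD m j g]].

Arguments jet_ideal {n k} m I.

Definition jet_closure n (k : comNzRingType) m (I : set (mseries n k)) :
    set (mseries n k) :=
  [set f | forall j, (j <= m)%N -> jet_ideal m I (jetD m j f)].

Arguments jet_closure {n k} m I.

(* Main.v *)
Require Import Defs.
From HB Require Import structures.
From mathcomp Require Import all_boot all_order all_algebra.
From mathcomp Require Import boolp classical_sets.
From mathcomp Require Import mpoly.

(** Give the variable [x_i^(j)] the weight [j].  Since the arcs
    [sum_j x_i^(j) t^j] have no constant term, they only involve the products
    [x_i^(j) t^j], so that [D_j(g)] is isobaric of weight [j] for every
    series [g].  Suppose that [D_j(f)], with [j <= m], is a combination of
    generators [D_l(g)] of the jet ideal of level [m+1].  Comparing the parts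
    of weight [j], only the generators with [l <= j <= m] contribute; setting
    the variables [x_i^(m+1)], of weight [m+1], to zero then gives a
    combination in the jet ideal of level [m].

    The weight decomposition and the specialization are carried out together
    by the ring morphism [jet_weight] from [P_(m+1)] to [P_m[s]] that sends
    [x_i^(j)] to [s^j x_i^(j)] for [j <= m], and [x_i^(m+1)] to [0].  By
    [jet_weight_jetD] it sends [D_j(g)] to [s^j D_j(g)] when [j <= m], and
    [D_(m+1)(g)] to a multiple of [s^(m+1)].  The elements whose image has its
    coefficients of [s^0, ..., s^m] in a given ideal form an ideal
    ([is_ideal_low_coef]); for the jet ideal of level [m], this ideal contains
    the generators of level [m+1], hence [D_j(f)], and the coefficient of
    [s^j] in the image of [D_j(f)] is [D_j(f)] itself. *)

Set Implicit Arguments.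
Unset Strict Implicit.
Unset Printing Implicit Defensive.

Import GRing.Theory.
Local Open Scope ring_scope.
Local Open Scope classical_set_scope.

Lemma is_ideal_gen (A : comNzRingType) (S : set A) : is_ideal (ideal_gen S).
Proof.
split=> [J [[] //]|a b Ia Ib J HJ|c a Ia J HJ].
- by have [[_ addJ _] _] := HJ; apply: addJ; [apply: Ia | apply: Ib].
- by have [[_ _ mulJ] _] := HJ; apply: mulJ; apply: Ia.
Qed.

Lemma ideal_sum (A : comNzRingType) (J : set A) (T : Type) (r : seq T)
    (P : pred T) (F : T -> A) :
  is_ideal J -> (forall i, P i -> J (F i)) -> J (\sum_(i <- r | P i) F i).
Proof. by case=> J0 JD _ JF; apply: big_ind. Qed.

(** The coefficients of [s^0, ..., s^m] of a product only depend on those of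
    its factors, and linearly so on those of either factor. *)
Lemma is_ideal_low_coef (A B : comNzRingType) (phi : {rmorphism B -> {poly A}})
    (m : nat) (J : set A) :
  is_ideal J -> is_ideal [set p | forall l, (l <= m)%N -> J (phi p)`_l].
Proof.
move=> idJ; have [J0 JD JM] := idJ; split=> [l _|a b Ja Jb l le_lm|c a Ja l le_lm].
- by rewrite rmorph0 coef0.
- by rewrite rmorphD coefD; apply: JD; [apply: Ja | apply: Jb].
- rewrite rmorphM coefM; apply: ideal_sum => // i _.
  by apply: JM; apply: Ja; rewrite (leq_trans (leq_subr _ _)).
Qed.

(** With [s] the variable of [{poly A}] and [t] that of [q] and [r], this says
    that [phi], applied to the coefficients of [q(t)], gives [r(s t)]. *)
Definition rescales (A B : comNzRingType) (phi : B -> {poly A})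
    (q : {poly B}) (r : {poly A}) : Prop :=
  forall j, phi q`_j = r`_j *: 'X^j.

Section Rescales.
Variables (A B : comNzRingType) (phi : {rmorphism B -> {poly A}}).
Implicit Types (q : {poly B}) (r : {poly A}).

Lemma rescales0 : rescales phi 0 0.
Proof. by move=> j; rewrite !coef0 rmorph0 scale0r. Qed.

Lemma rescalesC b a : phi b = a%:P -> rescales phi b%:P a%:P.
Proof.
move=> phib [|j]; rewrite !coefC /=; first by rewrite expr0 alg_polyC.
by rewrite rmorph0 scale0r.
Qed.

Lemma rescalesD q q' r r' :
  rescales phi q r -> rescales phi q' r' -> rescales phi (q + q') (r + r').
Proof. by move=> qr qr' j; rewrite !coefD rmorphD qr qr' scalerDl. Qed.

Lemma rescalesM q q' r r' :
  rescales phi q r -> rescales phi q' r' -> rescales phi (q * q') (r * r').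
Proof.
move=> qr qr' j; rewrite !coefM rmorph_sum scaler_suml; apply: eq_bigr => i _.
by rewrite rmorphM qr qr' -!mul_polyC mulrACA -polyCM -exprD subnKC // -ltnS.
Qed.

Lemma rescales1 : rescales phi 1 1.
Proof. by rewrite -!polyC1; apply: rescalesC; rewrite rmorph1. Qed.

Lemma rescales_exp q r a : rescales phi q r -> rescales phi (q ^+ a) (r ^+ a).
Proof.
move=> qr; elim: a => [|a IHa]; first by rewrite !expr0; apply: rescales1.
by rewrite !exprS; apply: rescalesM.
Qed.

(** Weight is compatible with substitution: it is enough to check rescaling on
    the constants and on the polynomials substituted for the variables. *)
Lemma rescales_mmap (n : nat) (k : comNzRingType) (b : k -> B) (a : k -> A)
    (u : 'I_n -> {poly B}) (v : 'I_n -> {poly A}) (p : {mpoly k[n]}) :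
    (forall c, phi (b c) = (a c)%:P) ->
    (forall i, rescales phi (u i) (v i)) ->
  rescales phi (mmap (polyC \o b) u p) (mmap (polyC \o a) v p).
Proof.
move=> ba uv; rewrite /mmap; apply: (big_ind2 (rescales phi)).
- exact: rescales0.
- by move=> *; apply: rescalesD.
move=> e _; apply: rescalesM; first exact: rescalesC.
rewrite /mmap1; apply: (big_ind2 (rescales phi)).
- exact: rescales1.
- by move=> *; apply: rescalesM.
- by move=> i _; apply: rescales_exp.
Qed.

End Rescales.

Section JetWeight.
Variables (n : nat) (k : comNzRingType) (m : nat).

Definition jet_weight_var : 'I_(n * m.+1) -> {poly jet_ring n k m} :=
  mxvec (\matrix_(i < n, j < m.+1)
    if unlift ord_max j is Some j'
    then ('X_(mxvec_index i j') : jet_ring n k m) *: 'X^(j'.+1) else 0) 0.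

Definition jet_weight : jet_ring n k m.+1 -> {poly jet_ring n k m} :=
  mmap (polyC \o @mpolyC (n * m) k) jet_weight_var.

HB.instance Definition _ := GRing.RMorphism.on jet_weight.

Lemma jet_weightX i j :
  jet_weight 'X_(mxvec_index i j) =
  if unlift ord_max j is Some j'
  then ('X_(mxvec_index i j') : jet_ring n k m) *: 'X^(j'.+1) else 0.
Proof. by rewrite /jet_weight mmapX mmap1U /jet_weight_var mxvecE mxE. Qed.

Lemma jet_weight_arc i :
  rescales jet_weight (jet_arc k m.+1 i) (@jet_arc n k m i).
Proof.
move=> l; rewrite /jet_arc !coef_sum rmorph_sum scaler_suml big_ord_recr /=.
rewrite [X in _ + X](_ : _ = 0) ?addr0; last first.
  rewrite coefZ rmorphM /= jet_weightX.
  by rewrite unlift_none mul0r.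
apply: eq_bigr => j _; rewrite !coefZ !coefXn.
have [->|_] := eqVneq l j.+1; last by rewrite !mulr0 rmorph0 scale0r.
rewrite !mulr1 jet_weightX.
have -> : widen_ord (leqnSn m) j = lift ord_max j.
  by apply: val_inj; rewrite /= /bump leqNgt ltn_ord.
by rewrite liftK.
Qed.

Lemma jet_weight_subst (p : {mpoly k[n]}) :
  rescales jet_weight (jet_subst m.+1 p) (jet_subst m p).
Proof.
apply: rescales_mmap => [c|i]; first exact: mmapC.
exact: jet_weight_arc.
Qed.

(** For [j = m.+1] the factor [c] is the coefficient of [t^j] along an arc
    truncated at [t^m], which is not a generator of the jet ideal of level
    [m]; such an element is excluded by its power of [s] alone. *)
Lemma jet_weight_jetD_ex j (g : mseries n k) :
  exists c, jet_weight (jetD m.+1 j g) = c *: 'X^j.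
Proof. by eexists; apply: jet_weight_subst. Qed.

Lemma jet_weight_jetD j (g : mseries n k) : (j <= m)%N ->
  jet_weight (jetD m.+1 j g) = jetD m j g *: 'X^j.
Proof.
by move=> le_jm; rewrite (@jetDE _ _ m m.+2) //; apply: jet_weight_subst.
Qed.

Lemma jet_ideal_jet_weight (I : set (mseries n k)) p l :
  jet_ideal m.+1 I p -> (l <= m)%N -> jet_ideal m I (jet_weight p)`_l.
Proof.
move=> Ip; move: l; apply: (Ip [set p | forall l, _]); split.
  exact: is_ideal_low_coef (is_ideal_gen _).
move=> _ [g [j [Ig le_jm1 ->]]] l le_lm.
have [J0 _ _] := is_ideal_gen [set p | exists g j,
  [/\ I g, (j <= m)%N & p = jetD m j g]].
have [eq_lj | neq_lj] := eqVneq l j; last first.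
  have [c ->] := jet_weight_jetD_ex j g.
  by rewrite coefZ coefXn (negbTE neq_lj) mulr0.
rewrite -eq_lj jet_weight_jetD // coefZ coefXn eqxx mulr1 => J [_ genJ].
by apply: genJ; exists g, l.
Qed.

Lemma jet_closureS_subset (I : set (mseries n k)) :
  jet_closure m.+1 I `<=` jet_closure m I.
Proof.
move=> f fI j le_jm.
have := jet_ideal_jet_weight (fI j (leqW le_jm)) le_jm.
by rewrite jet_weight_jetD // coefZ coefXn eqxx mulr1.
Qed.

End JetWeight.

Theorem proposition6p2 (k : closedFieldType) (char0 : [pchar k] =i pred0)
    (n : nat) (I : set (mseries n k)) (idealI : is_ideal I) (m : nat) :
  jet_closure m.+1 I `<=` jet_closure m I.
Proof. exact: jet_closureS_subset. Qed.
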